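(* Let $1\le m\le k\le N$. For all pairwise distinct nodes $x_1,\ldots,x_m\in Y_N$, the $m$-point correlation function of the ensemble $DOPE^{\mathrm{sym}}(N,k)$ is a determinant, \[ R_m^{(N,k)}(x_1,\ldots,x_m)=\det\left(K_{N,k}(x_i,x_j)\right)_{i,j=1,\ldots,m}, \] where the kernel $K_{N,k}$ can be expressed as \[ K_{N,k}(x,y)=\widehat K_{2N,2k}(x,y)-\widehat K_{2N,2k}(x,-y),\qquad x,y\in Y_N, \] and $\widehat K_{2N,2k}$ is the correlation kernel of $DOPE(2N,2k)$.
   Context: Let $b>0$, let $Y_N=\{y_{N,0}<\ldots<y_{N,N-1}\}\subset(0,b]$ be a set of $N$ nodes and $w_N:Y_N\to(0,\infty)$ a positive weight function. $DOPE^{\mathrm{sym}}(N,k)$ is the probability distribution on $k$-tuples $x_1<\ldots<x_k$ of elements of $Y_N$ given by \[ p_{\mathrm{sym}}^{(N,k)}(x_1,\ldots,x_k)=\frac1{Z^{\mathrm{sym}}_{N,k}}\prod_{i=1}^k x_i^2w_N(x_i)\prod_{1\le i<j\le k}(x_j^2-x_i^2)^2, \] with $Z^{\mathrm{sym}}_{N,k}$ a normalisation constant. The elements of a configuration are called particles. The $m$-point correlation function is $R_m^{(N,k)}(x_1,\ldots,x_m)=\mathbb P(\text{there are particles at each of the sites }x_1,\ldots,x_m)$. Let $X_{2N}=-Y_N\cup Y_N$ and let $\widehat w_{2N}$ be the even extension of $w_N$ to $X_{2N}$, i.e. $\widehat w_{2N}(x)=w_N(|x|)$. $DOPE(2N,2k)$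 is the distribution on $2k$-tuples $x_1<\ldots<x_{2k}$ of elements of $X_{2N}$ with probabilities proportional to $\prod_{i}\widehat w_{2N}(x_i)\prod_{i<j}(x_j-x_i)^2$. Let $p_{2N,0},\ldots,p_{2N,2N-1}$ be the orthonormal polynomials ($\deg p_{2N,j}=j$, positive leading coefficient) with respect to the scalar product $\sum_{x\in X_{2N}}\widehat w_{2N}(x)f(x)\overline{g(x)}$. The correlation kernel of $DOPE(2N,2k)$ is \[ \widehat K_{2N,2k}(x,y)=\sqrt{\widehat w_{2N}(x)\widehat w_{2N}(y)}\sum_{n=0}^{2k-1}p_{2N,n}(x)p_{2N,n}(y),\qquad x,y\in X_{2N}. \] *)

(* Defs.v *)
From HB Require Import structures.
From mathcomp Require Import all_boot all_order all_algebra.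
From mathcomp Require Import finmap.

Set Implicit Arguments.
Unset Strict Implicit.
Unset Printing Implicit Defensive.

Import Order.TTheory GRing.Theory Num.Theory.
Local Open Scope fset_scope.
Local Open Scope ring_scope.

(* The nodes form a finite set Y of elements of a real closed field R (e.g. the
   real numbers).  A weight on a finite set of nodes is a function on all of R,
   of which only the values at the nodes are ever used. *)

(* A k-tuple x_1 < ... < x_k of elements of Y. *)
Definition increasing (R : rcfType) (Y : {fset R}) (k : nat)
    (x : k.-tuple Y) : bool :=
  sorted <%R [seq val z | z <- x].

Definition sym_density (R : rcfType) (Y : {fset R}) (w : R -> R) (k : nat)
    (x : k.-tuple Y) : R :=
  (\prod_(i < k) (val (tnth x i) ^+ 2 * w (val (tnth x i)))) *
  \prod_(i < k) \prod_(j < k | (i < j)%N)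
     (val (tnth x j) ^+ 2 - val (tnth x i) ^+ 2) ^+ 2.

Definition sym_Z (R : rcfType) (Y : {fset R}) (w : R -> R) (k : nat) : R :=
  \sum_(x : k.-tuple Y | increasing x) sym_density w x.

(* The probability of an increasing tuple x under DOPE^sym. *)
Definition sym_prob (R : rcfType) (Y : {fset R}) (w : R -> R) (k : nat)
    (x : k.-tuple Y) : R :=
  (sym_Z Y w k)^-1 * sym_density w x.

(* The probability that a DOPE^sym configuration has particles at each of the
   sites s 0, ..., s (m - 1). *)
Definition sym_correlation (R : rcfType) (Y : {fset R}) (w : R -> R)
    (k m : nat) (s : 'I_m -> Y) : R :=
  \sum_(x : k.-tuple Y | increasing x && [forall a, s a \in x]) sym_prob w x.

Definition sym_nodes (R : rcfType) (Y : {fset R}) : {fset R} :=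
  [fset - y | y in Y] `|` Y.

Definition even_ext (R : rcfType) (w : R -> R) : R -> R := fun x => w `|x|.

(* p 0, ..., p (n - 1) are the orthonormal polynomials for the weight w on X;
   they are uniquely determined by these conditions when w is positive on X and
   n <= #|` X|.  The values of p from index n on are irrelevant. *)
Definition orthonormal_polys (R : rcfType) (X : {fset R}) (w : R -> R)
    (n : nat) (p : nat -> {poly R}) : Prop :=
  [/\ forall j, (j < n)%N -> size (p j) = j.+1,
      forall j, (j < n)%N -> 0 < lead_coef (p j)
    & forall i j, (i < n)%N -> (j < n)%N ->
        \sum_(x <- X) w x * (p i).[x] * (p j).[x] = (i == j)%:R].

(* The correlation kernel of DOPE with l particles, weight w and orthonormal
   polynomials p. *)
Definition dope_kernel (R : rcfType) (w : R -> R) (p : nat -> {poly R})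
    (l : nat) (x y : R) : R :=
  Num.sqrt (w x * w y) * \sum_(0 <= n < l) (p n).[x] * (p n).[y].

Definition sym_kernel (R : rcfType) (w : R -> R) (p : nat -> {poly R})
    (k : nat) (x y : R) : R :=
  dope_kernel (even_ext w) p (2 * k) x y
  - dope_kernel (even_ext w) p (2 * k) x (- y).

(* Main.v *)
(* By parity of the p_n, the kernel is sum_(j < k) phi_j(x) phi_j(y) with
   phi_j = sqrt (2 w) p_(2j+1), and the phi_j are orthonormal on Y.  Since
   p_(2j+1)(x) = x q_j(x^2) with deg q_j = j, the density is, up to a constant,
   the square of the determinant of the phi_j(x_i).  Giving the weight X to
   every particle at one of the m prescribed sites and 1 to the others,
   Andréief's identity and det (1 + UV) = det (1 + VU) turn the total mass into
   det (1 + (X - 1) K); the correlation function is its coefficient of X^m. *)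

Require Import Defs.
From HB Require Import structures.
From mathcomp Require Import all_boot all_order all_algebra all_fingroup.
From mathcomp Require Import finmap ring lra.

Set Implicit Arguments.
Unset Strict Implicit.
Unset Printing Implicit Defensive.

Import Order.TTheory GRing.Theory Num.Theory.
Local Open Scope fset_scope.
Local Open Scope ring_scope.

(** * Determinant identities and coefficient extraction *)

(** Multiplying [L] by the same unitriangular block matrix, on the left or on the right, makes it
    block triangular; both products have the same determinant. *)
Lemma det_add1_mulmxC (A : comNzRingType) m n (U : 'M[A]_(m, n))
    (V : 'M[A]_(n, m)) :
  \det (1%:M + U *m V) = \det (1%:M + V *m U).
Proof.
pose L := block_mx 1%:M (- U) V 1%:M.
have <-: \det (block_mx 1%:M U 0 1%:M *m L) = \det (1%:M + U *m V).
  rewrite mulmx_block !mul1mx !mulmx1 !mul0mx !add0r addNr.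
  by rewrite det_lblock det1 mulr1.
have <-: \det (L *m block_mx 1%:M U 0 1%:M) = \det (1%:M + V *m U).
  rewrite mulmx_block !mul1mx !mulmx1 !mulmx0 !addr0 subrr.
  by rewrite det_lblock det1 mul1r addrC.
by rewrite !det_mulmx mulrC.
Qed.

Lemma coef_prod_affine (A : comNzRingType) m (F : 'I_m -> {poly A}) :
  (forall i, (size (F i) <= 2)%N) ->
  (\prod_i F i)`_m = \prod_i (F i)`_1.
Proof.
(* The induction must carry the degree bound along with the coefficient. *)
move=> szF; pose P (n : nat) (q : {poly A}) (c : A) :=
  (size q <= n.+1)%N /\ q`_n = c.
suff [] : P m (\prod_i F i) (\prod_i (F i)`_1) by [].
elim: m => [|m IHm] in F szF *.
  by rewrite /P !big_ord0 size_poly1 coefC.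
rewrite !big_ord_recr /=.
have [szq <-] := IHm _ (fun i => szF (widen_ord (leqnSn m) i)).
move: (\prod_(i < m) _) szq (F ord_max) (szF ord_max) => q szq f szf.
split.
  apply: leq_trans (size_polyMleq _ _) _.
  by have := leq_add szq szf; rewrite addn2; case: (_ + _)%N.
(* Only two terms of the convolution involve coefficients of [f] of degree at most 1, and the one
   with [q] in degree m+1 vanishes by the bound on [q]. *)
rewrite coefM big_ord_recr big_ord_recr /= big1 ?add0r => [|i _].
  by rewrite subnn subSnn [X in _ + X]mulrC [q`_m.+1]nth_default // mulr0 addr0.
rewrite [X in _ * X]nth_default ?mulr0 // (leq_trans szf) //.
by rewrite subSn ?ltnS ?subn_gt0 // ltnW.
Qed.

Lemma coef_det_affine (A : comNzRingType) m (M : 'M[{poly A}]_m) :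
  (forall i j, (size (M i j) <= 2)%N) ->
  (\det M)`_m = \det (\matrix_(i, j) (M i j)`_1).
Proof.
move=> szM; rewrite coef_sum; apply: eq_bigr => s _.
rewrite !mulr_sign.
have E : (\prod_i M i (s i))`_m =
    \prod_i (\matrix_(i, j) (M i j)`_1) i (s i).
  by rewrite coef_prod_affine //; apply: eq_bigr => i _; rewrite mxE.
by case: ifP => _; rewrite ?coefN E.
Qed.

(** * Determinantal sums over tuples *)

(* Andréief's identity. *)
Lemma sum_tuple_det_det (A : comNzRingType) (T : finType) k
    (a b : 'I_k -> T -> A) :
  \sum_(x : k.-tuple T) \det (\matrix_(i, j) a j (tnth x i)) *
                        \det (\matrix_(i, j) b j (tnth x i)) =
  \det (\matrix_(i, j) \sum_y a i y * b j y) *+ k`!.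
Proof.
pose M := \matrix_(i, j) \sum_y a i y * b j y.
transitivity (\sum_(s : 'S_k) \sum_(t : 'S_k) (-1) ^+ s * (-1) ^+ t *
                 \prod_i M (s i) (t i)).
  under [in LHS]eq_bigr => x _ do rewrite big_distrlr /=.
  rewrite exchange_big; apply: eq_bigr => s _.
  rewrite exchange_big; apply: eq_bigr => t _ /=.
  under eq_bigr => x _ do rewrite mulrACA -big_split /=.
  rewrite -mulr_sumr; congr (_ * _).
  (* A product of sums is a sum over functions from indices to points, and these functions are the
     tuples. *)
  under [RHS]eq_bigr => i _ do rewrite mxE.
  rewrite bigA_distr_bigA /=.
  rewrite (reindex (fun f : {ffun 'I_k -> T} => [tuple f i | i < k])) /=.
    by apply: eq_bigr => f _; apply: eq_bigr => i _; rewrite !mxE tnth_mktuple.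
  exists (fun x : k.-tuple T => [ffun i => tnth x i]) => [f _|x _].
    by apply/ffunP=> i; rewrite ffunE tnth_mktuple.
  by apply: eq_from_tnth => i; rewrite tnth_mktuple ffunE.
rewrite -/M -[in RHS](card_Sn k) -sumr_const.
apply: eq_big => [s|s _]; first by rewrite inE.
(* For fixed [s], the sum over [t] is the determinant of [M] with its rows permuted by [s]; the
   signs cancel, so each of the k! permutations contributes [\det M]. *)
transitivity ((-1) ^+ s * \det (row_perm s M)).
  rewrite /determinant mulr_sumr; apply: eq_bigr => t _; rewrite mulrA.
  congr (_ * _).
  by apply: eq_bigr => i _; rewrite [RHS]mxE.
by rewrite row_permE det_mulmx det_perm mulrA -signr_addb addbb mul1r.
Qed.

Lemma det_tuple_eq0 (A : comNzRingType) (T : eqType) k (f : 'I_k -> T -> A)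
    (x : k.-tuple T) :
  ~~ uniq x -> \det (\matrix_(i, j) f j (tnth x i)) = 0.
Proof.
move=> nux; have /injectivePn[i [j neq_ij eq_ij]] : ~~ injectiveb (tnth x).
  by apply: contra nux => /injectiveP/tuple_uniqP.
by apply: (determinant_alternate neq_ij) => l; rewrite !mxE eq_ij.
Qed.

Lemma sum_tuple_correlation (A : comNzRingType) (T : finType) k m
    (phi : 'I_k -> T -> A) (s : 'I_m -> T) :
  (forall i j, \sum_y phi i y * phi j y = (i == j)%:R) -> injective s ->
  \sum_(x : k.-tuple T | [forall a, s a \in x])
     \det (\matrix_(i, j) phi j (tnth x i)) ^+ 2 =
  \det (\matrix_(a, b) \sum_j phi j (s a) * phi j (s b)) *+ k`!.
Proof.
move=> phi_ortho s_inj.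
have us : uniq (codom s) by rewrite map_inj_uniq ?enum_uniq.
(* The marker [g] enters only one of the two determinants, so a tuple gets one factor ['X] per entry
   at a site. *)
pose g y : {poly A} := if y \in codom s then 'X else 1.
pose c i y : {poly A} := (phi i y)%:P.
have := sum_tuple_det_det (fun i y => g y * c i y) c.
set M := (X in _ = \det X *+ _) => /(congr1 (fun q : {poly A} => q`_m)).
pose U : 'M[{poly A}]_(k, m) := \matrix_(i, a) (('X - 1) * c i (s a)).
pose V : 'M[{poly A}]_(m, k) := \matrix_(a, i) c i (s a).
(* Write ['X] as [1 + ('X - 1)] at the sites: the first part gives the identity by orthonormality,
   the second is a sum over the m sites only. *)
have -> : M = 1%:M + U *m V.
  apply/matrixP => i j; rewrite !mxE.
  under eq_bigr => y _.
    have -> : g y * c i y * c j y =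
        c i y * c j y + (if y \in codom s then ('X - 1) * c i y * c j y else 0).
      rewrite /g; case: ifP => _; last by rewrite mul1r addr0.
      by rewrite mulrBl mul1r [in RHS]mulrBl addrC subrK.
    over.
  rewrite big_split /= -big_mkcond /=; congr (_ + _).
    under eq_bigr => y _ do rewrite -polyCM.
    by rewrite -rmorph_sum phi_ortho; case: (i == j).
  rewrite -(big_uniq _ us) codomE big_map big_enum /=.
  by apply: eq_bigr => a _; rewrite !mxE.
pose K a b := \sum_j phi j (s a) * phi j (s b).
(* After the swap the matrix has size m and entries affine in ['X] with slope [K a b], so the
   coefficient of degree m of its determinant is that of [K]. *)
have VUE a b : (1%:M + V *m U) a b =
    (K a b)%:P * 'X + ((a == b)%:R - K a b)%:P.
  rewrite !mxE polyCB addrCA -[X in _ * _ - X]mulr1 -mulrBr.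
  rewrite /K rmorph_sum mulr_suml; congr (_ + _); first by case: (a == b).
  by apply: eq_bigr => j _; rewrite !mxE mulrCA rmorphM mulrC.
rewrite det_add1_mulmxC coefMn coef_det_affine => [|a b]; last first.
  rewrite VUE size_MXaddC; case: ifP => // _.
  exact: size_polyC_leq1.
have -> : \matrix_(a, b) ((1%:M + V *m U) a b)`_1 = \matrix_(a, b) K a b.
  by apply/matrixP => a b; rewrite mxE VUE [RHS]mxE coefD coefMX !coefC addr0.
move <-; rewrite coef_sum big_mkcond; apply: eq_bigr => x _.
have -> : \det (\matrix_(i, j) (g (tnth x i) * c j (tnth x i))) =
    'X^(count (mem (codom s)) x) *
    (\det (\matrix_(i, j) phi j (tnth x i)))%:P.
  have -> : 'X^(count (mem (codom s)) x) =
      \det (diag_mx (\row_i g (tnth x i))).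
    rewrite det_diag; under [RHS]eq_bigr => i _ do rewrite mxE.
    rewrite -(big_tuple _ _ x xpredT g) -sum1_count big_mkcond /= expr_sum.
    by apply: eq_bigr => y _; rewrite /g; case: ifP.
  rewrite -det_map_mx -det_mulmx; congr (\det _).
  by apply/matrixP => i j; rewrite mul_diag_mx !mxE.
have -> : \det (\matrix_(i, j) c j (tnth x i)) =
    (\det (\matrix_(i, j) phi j (tnth x i)))%:P.
  rewrite -det_map_mx; congr (\det _).
  by apply/matrixP => i j; rewrite !mxE.
rewrite -mulrA -rmorphM coefXnM coefC.
(* A repeated entry could count one site twice, but then the determinant vanishes. *)
have [ux | /(det_tuple_eq0 phi)->] := boolP (uniq x); last first.
  by rewrite expr0n mulr0 !if_same.
(* Without repetitions, the entries lying at sites are as many as the sites that are occupied, so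
   there are m of them exactly when every site is. *)
have -> : [forall a, s a \in x] = (count (mem (codom s)) x == m).
  have -> : count (mem (codom s)) x = count (mem x) (codom s).
    rewrite -!size_filter; apply: perm_size; apply: uniq_perm.
    - exact: filter_uniq.
    - exact: filter_uniq.
    - by move=> y; rewrite !mem_filter andbC.
  rewrite -[X in _ == X]card_ord -[X in _ == X](size_codom s) -all_count.
  apply/forallP/allP => [sx _ /codomP[a ->]|sx a]; first exact: sx.
  exact/sx/codom_f.
rewrite -expr2 subn_eq0.
by case: (ltngtP m (count _ _)).
Qed.

(** * Parity of the orthonormal polynomials *)

Lemma poly_span (F : fieldType) (p : nat -> {poly F}) n :
  (forall j, (j < n)%N -> size (p j) = j.+1) ->
  forall q : {poly F}, (size q <= n)%N -> exists c : nat -> F,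
    q = \sum_(j < n) c j *: p j.
Proof.
elim: n => [_ q|n IHn sz_p q szq].
  by rewrite size_poly_leq0 => /eqP ->; exists (fun=> 0); rewrite big_ord0.
pose a := q`_n / lead_coef (p n).
have lead_neq0 : lead_coef (p n) != 0.
  by rewrite lead_coef_eq0 -size_poly_eq0 sz_p.
have [||c def_q] := IHn _ (q - a *: p n).
- by move=> j ltjn; rewrite sz_p // ltnW.
- apply/leq_sizeP => i; rewrite leq_eqVlt coefB coefZ => /predU1P[<-|ltni].
    have <- : lead_coef (p n) = (p n)`_n by rewrite /lead_coef sz_p.
    by rewrite divfK // subrr.
  by rewrite !nth_default ?mulr0 ?subrr ?sz_p // (leq_trans szq).
exists (fun j => if j == n then a else c j).
rewrite big_ord_recr /= eqxx -[LHS](subrK (a *: p n)) def_q; congr (_ + _).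
by apply: eq_bigr => j _; rewrite ltn_eqF.
Qed.

(** Positivity keeps [Y] disjoint from its mirror image, so no node is counted twice. *)
Lemma sum_sym_nodes (R : rcfType) (Y : {fset R}) (f : R -> R) :
  (forall y, y \in Y -> 0 < y) ->
  \sum_(x <- sym_nodes Y) f x = \sum_(y <- Y) f y + \sum_(y <- Y) f (- y).
Proof.
move=> Y_gt0; rewrite -(big_map -%R xpredT f) -big_cat /=.
apply: perm_big; apply: uniq_perm => [||x]; first exact: fset_uniq.
  rewrite cat_uniq fset_uniq (map_inj_uniq oppr_inj) fset_uniq /= andbT.
  apply/hasPn => _ /mapP[y Yy ->]; apply/negP => /Y_gt0.
  by rewrite oppr_gt0 ltNge ltW ?Y_gt0.
rewrite mem_cat in_fsetU orbC; congr (_ || _).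
by apply/imfsetP/mapP => -[y Yy ->]; exists y.
Qed.

(** The reflection of [p i], multiplied by [(-1) ^+ i], has the same leading coefficient as [p i]
    and is also orthogonal to all lower degrees. The difference [d] therefore has degree below i and
    is orthogonal to every [p l] with l < i, which forces it to be zero. *)
Lemma orthonormal_polysN (R : rcfType) (X : {fset R}) (w : R -> R) n
    (p : nat -> {poly R}) :
  (forall f : R -> R, \sum_(x <- X) f (- x) = \sum_(x <- X) f x) ->
  (forall x, w (- x) = w x) ->
  orthonormal_polys X w n p ->
  forall i x, (i < n)%N -> (p i).[- x] = (-1) ^+ i * (p i).[x].
Proof.
move=> X_sym w_even [sz_p _ p_ortho] i x lt_in.
pose ip (f g : {poly R}) := \sum_(x <- X) w x * f.[x] * g.[x].
have ip_low (q : {poly R}) j : (j < n)%N -> (size q <= j)%N -> ip (p j) q = 0.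
  move=> lt_jn szq.
  have [c ->] := poly_span (fun l ltlj => sz_p l (ltn_trans ltlj lt_jn)) szq.
  rewrite /ip; under eq_bigr => y _ do rewrite horner_sum mulr_sumr.
  rewrite exchange_big big1 // => l _ /=.
  under eq_bigr => y _ do rewrite hornerZ mulrCA.
  by rewrite -mulr_sumr p_ortho ?(ltn_trans (ltn_ord l)) // gtn_eqF // mulr0.
pose flip (q : {poly R}) := \poly_(l < size q) ((-1) ^+ l * q`_l).
have flipE q y : (flip q).[y] = q.[- y].
  rewrite horner_poly horner_coef; apply: eq_bigr => l _.
  by rewrite [in RHS]exprNn [RHS]mulrCA mulrA.
have coef_flip q l : (flip q)`_l = (-1) ^+ l * q`_l.
  by rewrite coef_poly; case: ltnP => // ?; rewrite nth_default ?mulr0.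
pose d := (-1) ^+ i *: flip (p i) - p i.
suff d0 : d = 0.
  have := congr1 (fun q : {poly R} => q.[x]) d0.
  rewrite hornerE hornerZ flipE horner0 hornerN => /subr0_eq <-.
  by rewrite mulrA -exprMn mulrNN mulr1 expr1n mul1r.
have szd : (size d <= i)%N.
  apply/leq_sizeP => l; rewrite coefB coefZ coef_flip leq_eqVlt.
  case/predU1P => [<-|ltil].
    by rewrite mulrA -exprMn mulrNN mulr1 expr1n mul1r subrr.
  by rewrite nth_default ?mulr0 ?subr0 // sz_p.
have [c def_d] := poly_span (fun l ltli => sz_p l (ltn_trans ltli lt_in)) szd.
rewrite def_d big1 // => l _.
have lt_ln := ltn_trans (ltn_ord l) lt_in.
have : ip d (p l) = c l.
  rewrite def_d /ip.
  under eq_bigr => y _ do rewrite horner_sum mulr_sumr mulr_suml.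
  rewrite exchange_big (bigD1 l) //= [X in _ + X]big1 ?addr0 => [|j neq_jl].
    under eq_bigr => y _ do rewrite hornerZ mulrCA -mulrA.
    by rewrite -mulr_sumr p_ortho // eqxx mulr1.
  under eq_bigr => y _ do rewrite hornerZ mulrCA -mulrA.
  rewrite -mulr_sumr p_ortho ?(ltn_trans (ltn_ord j)) //.
  by rewrite -val_eqE in neq_jl; rewrite (negPf neq_jl) mulr0.
suff -> : ip d (p l) = 0 by move=> <-; rewrite scale0r.
(* Symmetry of the nodes and of the weight moves the reflection from [p i] onto [p l], whose degree
   stays below i. *)
have -> : ip d (p l) = (-1) ^+ i * ip (p i) (flip (p l)) - ip (p i) (p l).
  rewrite mulr_sumr -[X in X - _]X_sym -sumrB; apply: eq_bigr => y _.
  rewrite hornerD hornerN hornerZ !flipE w_even opprK; ring.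
by rewrite !ip_low ?mulr0 ?subr0 ?sz_p // (leq_trans (size_poly _ _)) ?sz_p.
Qed.

(** * Passing from increasing tuples to all tuples *)

Lemma increasingE (R : rcfType) (Y : {fset R}) k (x : k.-tuple Y) :
  increasing x = uniq x && sorted (relpre val <=%R) x.
Proof.
by rewrite /increasing lt_sorted_uniq_le sorted_map (map_inj_uniq val_inj).
Qed.

(** Sorting splits the tuples without repetition into classes of k! rearrangements, each containing
    one increasing tuple. *)
Lemma sum_tuple_increasing (R : rcfType) (Y : {fset R}) (V : nmodType) k
    (F : k.-tuple Y -> V) :
  (forall x : k.-tuple Y, ~~ uniq x -> F x = 0) ->
  (forall x y : k.-tuple Y, perm_eq x y -> F x = F y) ->
  \sum_x F x = (\sum_(x | increasing x) F x) *+ k`!.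
Proof.
move=> F_nuniq F_perm; pose leY : rel Y := relpre val <=%R.
have leY_total : total leY by move=> x y; apply: le_total.
have leY_trans : transitive leY by move=> x y z; apply: le_trans.
have leY_anti : antisymmetric leY by move=> x y /le_anti/val_inj.
pose srt (x : k.-tuple Y) : k.-tuple Y := sort_tuple leY x.
rewrite (bigID (fun x : k.-tuple Y => uniq x)) /=.
rewrite [X in _ + X]big1 ?addr0 => [|x /F_nuniq //].
rewrite (partition_big srt (fun x => increasing x)) /= => [|x ux]; last first.
  by rewrite increasingE sort_uniq ux sort_sorted.
rewrite -sumrMnl; apply: eq_bigr => y; rewrite increasingE => /andP[uy sy].
have classE (x : k.-tuple Y) : uniq x && (srt x == y) = perm_eq x y.
  apply/andP/idP => [[_ /eqP <-]|xy]; first by rewrite perm_sym perm_sort.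
  split; first by rewrite (perm_uniq xy).
  apply/eqP/val_inj/(sorted_eq leY_trans leY_anti) => //=.
    exact: sort_sorted.
  by rewrite perm_sort.
rewrite (eq_bigl _ _ classE) (eq_bigr (fun=> F y)); last by move=> x /F_perm.
rewrite sumr_const; congr (_ *+ _).
have <- : size (permutations y) = k`! by rewrite size_permutations ?size_tuple.
rewrite cardE -(size_map val); apply/perm_size/uniq_perm.
- by rewrite (map_inj_uniq val_inj) enum_uniq.
- exact: permutations_uniq.
move=> s; rewrite mem_permutations; apply/mapP/idP => [[x]|sy'].
  by rewrite mem_enum => ? ->.
have sz_s : size s == k by rewrite (perm_size sy') size_tuple.
by exists (Tuple sz_s); rewrite ?mem_enum.
Qed.

Lemma sqr_det_perm (A : comNzRingType) (T : eqType) k (f : 'I_k -> T -> A)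
    (x y : k.-tuple T) :
  perm_eq x y ->
  \det (\matrix_(i, j) f j (tnth x i)) ^+ 2 =
  \det (\matrix_(i, j) f j (tnth y i)) ^+ 2.
Proof.
move=> /tuple_permP[s x_s].
have -> : \matrix_(i, j) f j (tnth x i) =
    row_perm s (\matrix_(i, j) f j (tnth y i)).
  apply/matrixP => i j; rewrite !mxE; congr (f j _).
  have -> : x = [tuple tnth y (s i) | i < k] by apply: val_inj.
  by rewrite tnth_mktuple.
by rewrite row_permE det_mulmx det_perm exprMn sqrr_sign mul1r.
Qed.

(** * The density as a squared determinant *)

Lemma horner_odd_poly (R : realFieldType) (q : {poly R}) y :
  q.[- y] = - q.[y] -> q.[y] = y * (odd_poly q).[y ^+ 2].
Proof.
rewrite -{1 2 3}[q]poly_even_odd !hornerE !horner_comp !hornerE sqrrN => q_odd.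
have : (even_poly q).[y ^+ 2] = 0 by lra.
by move=> ->; rewrite add0r mulrC.
Qed.

(** The matrix factors into a diagonal matrix, a Vandermonde matrix in the squared nodes and the
    coefficient matrix [Q] of the odd parts. *)
Lemma sym_density_det (R : rcfType) (Y : {fset R}) (w : R -> R) k
    (q : 'I_k -> {poly R}) :
  (forall y, y \in Y -> 0 <= w y) ->
  (forall j, size (q j) = j.*2.+2) ->
  (forall j y, (q j).[- y] = - (q j).[y]) ->
  exists2 C, C != 0 & forall x : k.-tuple Y,
    \det (\matrix_(i, j) (Num.sqrt (2 * w (val (tnth x i))) *
                          (q j).[val (tnth x i)])) ^+ 2 = C * sym_density w x.
Proof.
move=> w_ge0 sz_q q_odd.
pose Q : 'M_k := \matrix_(l, j) (odd_poly (q j))`_l.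
have sz_odd j : size (odd_poly (q j)) = j.+1.
  by rewrite size_odd_poly_eq sz_q /= ?odd_double ?doubleK.
have detQ : \det Q != 0.
  (* [Q] is upper triangular with nonzero diagonal, since the odd part of [q j] has degree exactly
     j. *)
  rewrite -det_tr det_trig; last first.
    by apply/is_trig_mxP => i j lt_ij; rewrite !mxE nth_default // sz_odd.
  apply/prodf_neq0 => j _; rewrite !mxE.
  have -> : (odd_poly (q j))`_j = lead_coef (odd_poly (q j)).
    by rewrite lead_coefE sz_odd.
  by rewrite lead_coef_eq0 -size_poly_eq0 sz_odd.
(* The power of 2 comes from the k factors [Num.sqrt (2 * w _)], the rest from the change of basis
   [Q]. *)
exists (2 ^+ k * \det Q ^+ 2) => [|x].
  by rewrite mulf_neq0 ?expf_neq0 // pnatr_eq0.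
pose u i := val (tnth x i).
pose d : 'rV_k := \row_i (Num.sqrt (2 * w (u i)) * u i).
pose a : 'rV_k := \row_i (u i ^+ 2).
have -> : \matrix_(i, j) (Num.sqrt (2 * w (u i)) * (q j).[u i]) =
    diag_mx d *m ((Vandermonde k a)^T *m Q).
  apply/matrixP => i j; rewrite mul_diag_mx !mxE horner_odd_poly // mulrA.
  rewrite (@horner_coef_wide _ k) ?sz_odd //; congr (_ * _).
  by apply: eq_bigr => l _; rewrite !mxE mulrC.
rewrite !det_mulmx det_tr det_Vandermonde det_diag !exprMn mulrA.
rewrite mulrC [2 ^+ k * _]mulrC -[RHS]mulrA; congr (_ * _).
rewrite /sym_density mulrA -!prodrXl; congr (_ * _).
  rewrite -[X in 2 ^+ X]card_ord -prodr_const -big_split /=.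
  apply: eq_bigr => i _; rewrite mxE exprMn sqr_sqrtr ?mulr_ge0 ?w_ge0 //.
    by rewrite -mulrA [w _ * _]mulrC.
  exact: valP.
apply: eq_bigr => i _; rewrite -prodrXl; apply: eq_bigr => j _.
by rewrite !mxE.
Qed.

Lemma sum_nat_double (V : nmodType) k (F : nat -> V) :
  \sum_(0 <= n < k.*2) F n = \sum_(j < k) (F j.*2 + F j.*2.+1).
Proof.
elim: k => [|k IHk]; first by rewrite big_geq // big_ord0.
by rewrite doubleS !big_nat_recr //= IHk big_ord_recr /= addrA.
Qed.

(** * The correlation functions of the symmetric ensemble *)

Theorem theorem3p1 (R : rcfType) (b : R) (hb : 0 < b)
    (N : nat) (Y : {fset R}) (cardY : #|` Y| = N)
    (Yb : forall y, y \in Y -> 0 < y <= b)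
    (w : R -> R) (w_gt0 : forall y, y \in Y -> 0 < w y)
    (p : nat -> {poly R})
    (hp : orthonormal_polys (sym_nodes Y) (even_ext w) (2 * N) p)
    (m k : nat) (m_gt0 : (1 <= m)%N) (le_mk : (m <= k)%N) (le_kN : (k <= N)%N)
    (x : 'I_m -> Y) (x_inj : injective x) :
  sym_correlation w k x =
    \det (\matrix_(i < m, j < m) sym_kernel w p k (val (x i)) (val (x j))).
Proof.
have Y_gt0 y : y \in Y -> 0 < y by case/Yb/andP.
have w_ge0 y : y \in Y -> 0 <= w y by move/w_gt0/ltW.
have nodesN (f : R -> R) :
    \sum_(y <- sym_nodes Y) f (- y) = \sum_(y <- sym_nodes Y) f y.
  rewrite !sum_sym_nodes // addrC; congr (_ + _).
  by apply: eq_bigr => y _; rewrite opprK.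
have evenN y : even_ext w (- y) = even_ext w y by rewrite /even_ext normrN.
have even_pos y : y \in Y -> even_ext w y = w y.
  by move=> Yy; rewrite /even_ext gtr0_norm ?Y_gt0.
have pN := orthonormal_polysN nodesN evenN hp.
have [sz_p _ p_ortho] := hp.
have lt_j (j : 'I_k) : (j.*2.+1 < 2 * N)%N.
  by rewrite mul2n -doubleS leq_double (leq_trans (ltn_ord j)).
have p_odd (j : 'I_k) y : (p j.*2.+1).[- y] = - (p j.*2.+1).[y].
  by rewrite pN // exprS -signr_odd odd_double expr0 mulr1 mulN1r.
(* A product of two odd polynomials takes equal values at a node and at its mirror image; the factor
   2 accounts for both when summing over [Y] alone. *)
pose phi (j : 'I_k) (y : Y) : R :=
  Num.sqrt (2 * w (val y)) * (p j.*2.+1).[val y].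
have phi_ortho i j : \sum_y phi i y * phi j y = (i == j)%:R.
  have := p_ortho _ _ (lt_j i) (lt_j j).
  rewrite eqSS (inj_eq double_inj) (inj_eq val_inj) => <-.
  rewrite sum_sym_nodes // -big_split /= [RHS]big_seq_fsetE /=.
  apply: eq_bigr => y _; have Yy := valP y.
  rewrite evenN !p_odd even_pos // /phi.
  transitivity (Num.sqrt (2 * w (val y)) ^+ 2 *
                (p i.*2.+1).[val y] * (p j.*2.+1).[val y]); first by ring.
  by rewrite sqr_sqrtr ?mulr_ge0 ?w_ge0 //; ring.
(* In the difference of the two kernels the terms of even index cancel and those of odd index
   double. *)
have kernelE (y z : Y) :
    sym_kernel w p k (val y) (val z) = \sum_j phi j y * phi j z.
  have [Yy Yz] := (valP y, valP z).
  rewrite /sym_kernel /dope_kernel evenN !even_pos // -mulrBr -sumrB.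
  rewrite mul2n sum_nat_double mulr_sumr; apply: eq_bigr => j _.
  rewrite p_odd pN; last by apply: ltn_trans (lt_j j).
  rewrite -signr_odd odd_double expr0 mul1r subrr add0r /phi.
  by rewrite !sqrtrM ?mulr_ge0 ?w_ge0 //; ring: (sqr_sqrtr (ler0n R 2)).
have [C C_neq0 density_det] := sym_density_det w_ge0
  (fun j : 'I_k => sz_p _ (lt_j j)) p_odd.
pose D (t : k.-tuple Y) := \det (\matrix_(i, j) phi j (tnth t i)) ^+ 2.
have fact_inj : injective (fun r : R => r *+ k`!) := pmulrnI (fact_gt0 k).
(* The total over all tuples is k! times the determinant of the Gram matrix of [phi], which is the
   identity. *)
have sumD : \sum_(t : k.-tuple Y | increasing t) D t = 1.
  apply: fact_inj => /=; rewrite -sum_tuple_increasing => [|t|t t'].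
  - rewrite (sum_tuple_det_det phi phi).
    have -> : \matrix_(i, j) \sum_y phi i y * phi j y = 1%:M.
      by apply/matrixP => i j; rewrite !mxE.
    by rewrite det1.
  - by move=> /(det_tuple_eq0 phi) D0; rewrite /D D0 expr0n.
  - exact: sqr_det_perm.
(* Since [D] has total mass 1, the normalisation cancels the unknown constant [C]. *)
have probE (t : k.-tuple Y) : sym_prob w t = D t.
  have densE (t' : k.-tuple Y) : sym_density w t' = C^-1 * D t'.
    by rewrite [D _]density_det mulKf.
  rewrite /sym_prob /sym_Z.
  under eq_bigr => t' _ do rewrite densE.
  by rewrite -mulr_sumr sumD mulr1 densE mulrA mulVf ?mul1r ?invr_eq0.
(* Multiplying both sides by k! turns the sum over increasing tuples into one over all tuples;
   containing every site does not depend on the order of the entries. *)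
apply: fact_inj => /=.
under [in RHS]eq_mx => i j do rewrite kernelE.
rewrite -sum_tuple_correlation // [RHS]big_mkcond.
rewrite sum_tuple_increasing => [|t|t t' tt'].
- rewrite -big_mkcondr /=; congr (_ *+ _); exact: eq_bigr.
- by move=> /(det_tuple_eq0 phi) ->; rewrite expr0n if_same.
- rewrite (sqr_det_perm phi tt').
  suff -> : [forall a, x a \in t] = [forall a, x a \in t'] by [].
  by apply: eq_forallb => a; rewrite (perm_mem tt').
Qed.
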